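(* The edge-fair rule, which assigns to every problem $(G,s,d,u)$ the maximum flow selected by the edge-fair algorithm, is symmetric, continuous, and (edge-)consistent.
   Context: **Problems and flows.** A problem $(G,s,d,u)$ consists of a finite bipartite graph $G=(S\cup D,E)$ with suppliers $S$, demanders $D$ and edges $E\subseteq S\times D$; supplies $s_i\ge 0$ ($i\in S$); demands $d_j\ge 0$ ($j\in D$); and edge capacities $u_{ij}\in[0,\infty]$ ($(i,j)\in E$). A flow $\varphi=(\varphi_{ij})_{(i,j)\in E}$ has nonnegative entries and induces net transfers $x_i(\varphi)=\sum_{j:(i,j)\in E}\varphi_{ij}$ for $i\in S$ and $y_j(\varphi)=\sum_{i:(i,j)\in E}\varphi_{ij}$ for $j\in D$. It is feasible if $0\le\varphi_{ij}\le u_{ij}$ for all $(i,j)\in E$, $x_i(\varphi)\le s_i$ for all $i\in S$, and $y_j(\varphi)\le d_j$ for all $j\in D$. $\mathcal F(G,s,d,u)$ is the set of feasible flows, and $\mathcal F^*(G,s,d,u)$ is the set of maximum flows, i.e. feasible flows maximizing $\sum_{i\in S}x_i(\varphi)$. **Edge-fair algorithm.** Let $E_0=E$ and $\mathcal F_0=\mathcal F^*(G,s,d,u)$. At step $t=0,1,2,\dots$, as long as $E_t\neq\emptyset$, let $\lambda^*_{t+1}$ be the optimal value of $$\max_{\varphi\in\mathcal F_t}\{\lambda_{t+1}: \varphi_e\ge\lambda_{t+1}\ \ \forall e\in E_t\},$$ and set $\mathcal F_{t+1}=\{\varphi\in\mathcal F_t:\varphi_e\ge\lambda^*_{t+1}\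 \forall e\in E_t\}$ and $E_{t+1}=\{e\in E_t:\varphi_e>\lambda^*_{t+1}\text{ for some }\varphi\in\mathcal F_{t+1}\}$. At least one edge leaves the active set $E_t$ in each step; the algorithm stops when no active edge remains, and its output is the unique flow remaining. Equivalently, it is the unique lex-optimal maximum flow: the maximum flow whose vector of edge-flows, sorted in increasing order, is lexicographically largest among all maximum flows. **Axioms for a rule** (a map assigning to every problem $(G,s,d,u)$ a flow in it). - *Symmetry*: for every permutation $\pi$ of $S$ and $\sigma$ of $D$, let $(G',s',d',u')$ be the permuted problem, i.e. $(\pi(i),\sigma(j))$ is an edge of $G'$ iff $(i,j)$ is an edge of $G$, $s'_{\pi(i)}=s_i$, $d'_{\sigma(j)}=d_j$, $u'_{\pi(i)\sigma(j)}=u_{ij}$. If $z$ and $z'$ are the outcomes of the rule at $(G,s,d,u)$ and $(G',s',d',u')$, then $z_{ij}=z'_{\pi(i)\sigma(j)}$ for every edge $(i,j)$ of $G$. - *Continuity*: for each fixed $G$, the flow in $\mathbb R^{|E|}$ selected by the rule is jointly continuous in $(s,d,u)$. - *Edge consistency* (consistency): let $z$ be the outcome at $(G,s,d,u)$ and let $(i,j)\in E$. The reduced problem $(G',s',d',u)$ has $G'=G\setminus\{(i,j)\}$, $s'_i=s_i-z_{ij}$, $d'_j=d_j-z_{ij}$, all other supplies and demands unchanged, and the capacities of the remaining edges unchanged. The rule is edge-consistent if for every problem and every edge $(i,j)$, the outcome $z'$ at the reduced problem satisfies $z'_e=z_e$ for every edge $e$ of $G'$. *)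

(* Defs.v *)
From HB Require Import structures.
From mathcomp Require Export all_boot all_order all_algebra perm.
From mathcomp Require Export all_classical all_reals all_analysis.
Export numFieldNormedType.Exports.

Set Implicit Arguments.
Unset Strict Implicit.
Unset Printing Implicit Defensive.

Import Order.TTheory GRing.Theory Num.Theory.
Local Open Scope classical_set_scope.
Local Open Scope ring_scope.

(* Suppliers and demanders are distinct finite types, so that a set of pairs
   is a bipartite graph.  Capacities and flows are indexed by the edges only,
   not by all the pairs. *)
Definition edge (S D : finType) (E : {set S * D}) : finType :=
  {e : S * D | e \in E}.

Record problem (R : realType) (S D : finType) := Problem {
  graph : {set S * D};
  supply : S -> R;
  demand : D -> R;
  capacity : edge graph -> \bar R }.
Arguments capacity {R S D} p e.

Definition valid (R : realType) (S D : finType) (P : problem R S D) : Prop :=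
  [/\ forall i, 0 <= supply P i,
      forall j, 0 <= demand P j
    & forall e, (0 <= capacity P e)%E].

Definition flow (R : realType) (S D : finType) (P : problem R S D) : Type :=
  edge (graph P) -> R.

Section Algorithm.
Variables (R : realType) (S D : finType) (P : problem R S D).

Definition transferS (phi : flow P) (i : S) : R :=
  \sum_(e : edge (graph P) | (val e).1 == i) phi e.

Definition transferD (phi : flow P) (j : D) : R :=
  \sum_(e : edge (graph P) | (val e).2 == j) phi e.

Definition feasible : set (flow P) :=
  [set phi | [/\ forall e, 0 <= phi e /\ ((phi e)%:E <= capacity P e)%E,
                 forall i, transferS phi i <= supply P i
               & forall j, transferD phi j <= demand P j]].

Definition total (phi : flow P) : R := \sum_(i : S) transferS phi i.

Definition max_flows : set (flow P) :=
  [set phi | feasible phi /\ forall psi, feasible psi -> total psi <= total phi].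

Definition optimal_value (A : {set edge (graph P)}) (F : set (flow P)) : R :=
  sup [set l : R | exists2 phi, F phi & forall e, e \in A -> l <= phi e].

(* A state (E_t, F_t) holds the active edges and the remaining flows; it is
   left unchanged once no active edge remains. *)
Definition edge_fair_step (st : {set edge (graph P)} * set (flow P)) :
    {set edge (graph P)} * set (flow P) :=
  let: (A, F) := st in
  if A == finset.set0 then st else
  let l := optimal_value A F in
  let F' := [set phi | F phi /\ forall e, e \in A -> l <= phi e] in
  ([set e in A | `[< exists2 phi, F' phi & l < phi e >] ]%SET, F').

Definition edge_fair_state (t : nat) : {set edge (graph P)} * set (flow P) :=
  iter t edge_fair_step (finset.setT, max_flows).

(* The algorithm stops, and phi is the unique flow remaining when it does. *)
Definition edge_fair_output (phi : flow P) : Prop :=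
  exists t, (edge_fair_state t).1 = finset.set0 /\
            (edge_fair_state t).2 = [set phi].

(* The default value 0 is irrelevant as soon as the algorithm has an output. *)
Definition edge_fair : flow P := xget (fun=> 0) [set phi | edge_fair_output phi].

End Algorithm.

Definition rule (R : realType) : Type :=
  forall (S D : finType) (P : problem R S D), flow P.

Definition edge_fair_rule (R : realType) : rule R :=
  fun S D P => @edge_fair R S D P.

Definition selected_by_edge_fair_algorithm (R : realType) (f : rule R) : Prop :=
  forall (S D : finType) (P : problem R S D), valid P ->
    max_flows (f S D P) /\ edge_fair_output (f S D P).

(* P' is the problem obtained from P by permuting suppliers and demanders;
   the last clause relates the edge (i, j) of P to the edge
   (pi i, sigma j) of P'. *)
Definition permuted (R : realType) (S D : finType)
    (pi : {perm S}) (sigma : {perm D}) (P P' : problem R S D) : Prop :=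
  [/\ forall i j, ((pi i, sigma j) \in graph P') = ((i, j) \in graph P),
      forall i, supply P' (pi i) = supply P i,
      forall j, demand P' (sigma j) = demand P j
    & forall (e : edge (graph P)) (e' : edge (graph P')),
        val e' = (pi (val e).1, sigma (val e).2) ->
        capacity P' e' = capacity P e].

Definition symmetric_rule (R : realType) (f : rule R) : Prop :=
  forall (S D : finType) (pi : {perm S}) (sigma : {perm D})
    (P P' : problem R S D),
    valid P -> permuted pi sigma P P' ->
    forall (e : edge (graph P)) (e' : edge (graph P')),
      val e' = (pi (val e).1, sigma (val e).2) -> f S D P e = f S D P' e'.

(* For a fixed graph, data and flows carry the (finite) product topologies;
   capacities have the topology of the extended real line, so that continuity
   also covers infinite capacities. *)
Definition data (R : realType) (S D : finType) (E : {set S * D}) : Type :=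
  ({ptws S -> R} * {ptws D -> R} * {ptws edge E -> \bar R})%type.

HB.instance Definition _ (R : realType) (S D : finType) (E : {set S * D}) :=
  Topological.copy (data R E)
    ({ptws S -> R} * {ptws D -> R} * {ptws edge E -> \bar R})%type.

Definition problem_of (R : realType) (S D : finType) (E : {set S * D})
    (p : data R E) : problem R S D :=
  @Problem R S D E p.1.1 p.1.2 p.2.

Definition continuous_rule (R : realType) (f : rule R) : Prop :=
  forall (S D : finType) (E : {set S * D}),
    {within [set p : data R E | valid (problem_of p)],
      continuous (fun p : data R E =>
        (f S D (problem_of p) : {ptws edge E -> R}))}.

Lemma remaining_edge_subproof (S D : finType) (E : {set S * D}) (e0 : S * D)
  (e : edge (E :\ e0)) : val e \in E.
Proof. by case: e => /= x; rewrite in_setD1 => /andP[]. Qed.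

Definition remaining_edge (S D : finType) (E : {set S * D}) (e0 : S * D)
    (e : edge (E :\ e0)) : edge E :=
  exist _ (val e) (remaining_edge_subproof e).

Definition reduced (R : realType) (S D : finType) (P : problem R S D)
    (z : flow P) (e0 : edge (graph P)) : problem R S D :=
  @Problem R S D (graph P :\ val e0)
    (fun i => if i == (val e0).1 then supply P i - z e0 else supply P i)
    (fun j => if j == (val e0).2 then demand P j - z e0 else demand P j)
    (fun e => capacity P (remaining_edge e)).

Definition edge_consistent (R : realType) (f : rule R) : Prop :=
  forall (S D : finType) (P : problem R S D) (e0 : edge (graph P)), valid P ->
    forall e : edge (graph P :\ val e0),
      f S D (reduced (f S D P) e0) e = f S D P (remaining_edge e).

(* Main.v *)
Require Import Defs.
From mathcomp Require Import lra.

(** The edge-fair flow is singled out by one inequality.  Call a maximum flow z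
fair if no maximum flow w raises an edge f above z f without pushing some edge
e below min (z e, z f).

Two fair flows z and w coincide: among the edges where they differ, take f with
the smallest value min (z f, w f), and say z f < w f.  Every other difference
takes place at or above the level z f, so w respects all the bounds
min (z e, z f) and raises f; thus z is not fair ([fair_unique]).

The output of the algorithm is fair.  The maximum flows form a nonempty compact
set closed under midpoints, and each step keeps these properties.  Along the
steps, a maximum flow that respects the bounds min (z e, z f) of a surviving
flow z survives as long as f is active, and cannot exceed z f at the step that
drops f ([edge_fair_step_invariant]).  At least one edge drops out at each step:
otherwise a combination of surviving flows would exceed the optimal value on all
active edges ([common_excess]).  Once no edge is active all surviving flows are
fair, hence equal.

So the rule selects the unique fair flow, and its three properties reduce to
properties of fairness.
- Symmetry: fairness is transported by the bijection between the edges of a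
  problem and those of the permuted one ([pull_fair]).
- Consistency: adding the settled edge back turns a maximum flow of the reduced
  problem into one of the original problem, and on that edge it agrees with z;
  therefore z restricted to the remaining edges is fair ([restrict_fair]).
- Continuity: a limit psi of fair flows z_t is fair ([fair_limit]).  If a maximum
  flow w of the limit problem contradicts the fairness of psi, the flow
  z_t + (w - psi) / 2 contradicts that of z_t near the limit.  It is feasible
  there because a linear constraint that w - psi pushes against is slack at psi,
  with at least twice the room needed.  As flows are locally bounded, limits
  exist along ultrafilters, and uniqueness identifies them. *)

Set Implicit Arguments.
Unset Strict Implicit.
Unset Printing Implicit Defensive.

Import Order.TTheory GRing.Theory Num.Theory.
Local Open Scope classical_set_scope.
Local Open Scope ring_scope.

(** * Convergence and compactness *)

Lemma closed_forall (T : topologicalType) (I : finType) (B : I -> set T) :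
  (forall i, closed (B i)) -> closed [set x | forall i, B i x].
Proof.
move=> cB; rewrite [X in closed X](_ : _ = \bigcap_i B i).
  by apply: closed_bigI.
by apply/seteqP; split => x Bx i //; exact: Bx.
Qed.

Lemma cvg_ptws (I : Type) (T : topologicalType) (F : set_system (I -> T))
    (g : I -> T) : Filter F ->
  (forall i, h i @[h --> F] --> g i) -> F --> (g : {ptws I -> T}).
Proof.
move=> FF Fg; apply/cvg_sup => i A.
rewrite /= (@nbhsE (initial_topology (fun h : I -> T => h i))).
move=> -[B [[C oC <-] Cg] BA].
by apply: filterS BA _; apply: Fg; exact: open_nbhs_nbhs.
Qed.

(** If the preimage of a neighbourhood of l is not in F, its complement lies in an
ultrafilter finer than F, along which f does not converge to l. *)
Lemma cvg_of_ultra (T : Type) (U : topologicalType) (F : set_system T)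
    (f : T -> U) (l : U) : Filter F ->
  (forall G, UltraFilter G -> F `<=` G -> f @ G --> l) -> f @ F --> l.
Proof.
move=> FF ultra N Nl; apply: contrapT => notF.
pose C := ~` (f @^-1` N).
have PF : ProperFilter (within C F).
  split; last exact: within_filter.
  by rewrite /within /= => CF; apply: notF; apply: filterS CF => t /contrapT.
have [G [UG CG]] := ultraFilterLemma PF.
have FG : F `<=` G by move=> B FB; apply: CG; apply: filterS FB.
have GC : G C by apply: CG; exact: withinT.
have GN : G (f @^-1` N) := ultra G UG FG N Nl.
by have [t []] := filter_ex (filterI GC GN).
Qed.

Lemma ultra_bounded_cvg (T : Type) (R : realType) (G : set_system T)
    (x : T -> R) (a b : R) : UltraFilter G ->
  (\forall t \near G, a <= x t <= b) -> exists l : R, x @ G --> l.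
Proof.
move=> UG xab.
have [|l [_ cl]] := @segment_compact R a b (fmap x G) _.
  by apply: filterS xab => t; rewrite /= in_itv.
exists l; move=> N Nl; have [//|notN] := in_ultra_setVsetC (x @^-1` N) UG.
by have [y []] := cl (~` N) N notN Nl.
Qed.

Section SlackConstraints.
Variables (R : realType) (T : Type) (G : set_system T).
Context {FG : Filter G}.

Lemma lt_cvg_near (f g : T -> R) (a b : R) :
  f @ G --> a -> g @ G --> b -> a < b -> \forall t \near G, f t < g t.
Proof.
move=> fa gb ab; have fm : \forall t \near G, f t < (a + b) / 2.
  by apply: (cvgr_lt _ fa); lra.
have mg : \forall t \near G, (a + b) / 2 < g t.
  by apply: (cvgr_gt _ gb); lra.
by apply: filterS2 fm mg => t; exact: lt_trans.
Qed.

(** The constraint x t <= r t has room for half a step from the limit a of x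
towards b.  If b <= a the step goes down.  Otherwise a < b <= c, so the half step
stops strictly below the limit c of the bound.  Extended values of r serve for
infinite capacities. *)
Lemma slack_near (x : T -> R) (a b : R) (r : T -> \bar R) (c : \bar R) :
  x @ G --> a -> r @ G --> c -> (\forall t \near G, ((x t)%:E <= r t)%E) ->
  (b%:E <= c)%E ->
  \forall t \near G, ((x t + 2^-1 * (b - a))%:E <= r t)%E.
Proof.
move=> xa rc xr bc; have [ba|ab] := leP b a.
  apply: filterS xr => t; apply: le_trans; rewrite lee_fin; lra.
(* m lies halfway between the midpoint of a and b, where the step leads,
   and b. *)
pose m := (a + b * 3) / 4.
have mc : (m%:E < c)%E by apply: lt_le_trans bc; rewrite lte_fin /m; lra.
have xm : \forall t \near G, x t < a + (b - a) / 4.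
  by apply: (cvgr_lt _ xa); lra.
have mr : \forall t \near G, (m%:E < r t)%E := rc _ (open_ereal_gt' mc).
apply: filterS2 xm mr => t xm mr; apply: le_trans (ltW mr).
by rewrite lee_fin /m; lra.
Qed.

Lemma real_slack_near (x : T -> R) (a b : R) (r : T -> R) (c : R) :
  x @ G --> a -> r @ G --> c -> (\forall t \near G, x t <= r t) -> b <= c ->
  \forall t \near G, x t + 2^-1 * (b - a) <= r t.
Proof.
move=> xa rc xr bc.
have := @slack_near x a b (EFin \o r) c%:E xa.
under eq_near do rewrite /= lee_fin.
under [X in _ -> _ -> _ -> X]eq_near do rewrite /= lee_fin.
by apply => //; apply: cvg_EFin => //; exact: nearW.
Qed.

End SlackConstraints.

(** * Fair flows *)

Section FairFlows.
Variables (R : realType) (S D : finType) (P : problem R S D).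
Implicit Types (phi psi z w : flow P) (A : {set edge (graph P)})
  (F : set (flow P)).

(** Max-min fairness asks that a maximum flow w above z at f lower some edge e
with z e <= z f.  The maximum flows form a convex set, and on such a set it is
enough that w either do so or push another edge below z f, since w may be
replaced by a flow closer to z.  The bounds min (z e, z f) express this weaker
demand as lower bounds on w, like the constraints of the algorithm. *)
Definition fair z : Prop :=
  max_flows z /\
  forall w f, max_flows w -> (forall e, Num.min (z e) (z f) <= w e) ->
    w f <= z f.

Lemma fair_le_first_difference z w f : fair z -> max_flows w ->
  (forall e, z e != w e -> z f <= Num.min (z e) (w e)) -> w f <= z f.
Proof.
move=> [_ fz] mw zf; apply: fz => // e.
have [->|/zf] := eqVneq (z e) (w e); first by rewrite ge_min lexx.
by rewrite le_min ge_min => /andP[_ ->]; rewrite orbT.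
Qed.

(** Let f minimize min (z e, w e) over the edges e where z and w differ; the flow
that is smaller at f then fails to be fair. *)
Lemma fair_unique z w : fair z -> fair w -> z = w.
Proof.
move=> fz fw; apply: contrapT => zw.
have [e0 e0P] : exists e, z e != w e.
  apply: contrapT => /forallNP eqzw; apply: zw; apply/funext => e.
  exact/eqP/negPn/negP/eqzw.
pose m e := Num.min (z e) (w e).
have [f fP mf] := @arg_minP _ _ _ e0 (fun e => z e != w e) m e0P.
case: (ltgtP (z f) (w f)) fP => // zwf _.
  suff: w f <= z f by rewrite leNgt zwf.
  apply: (fair_le_first_difference fz (proj1 fw)) => e /mf.
  by rewrite {1}/m (min_l (ltW zwf)).
suff: z f <= w f by rewrite leNgt zwf.
apply: (fair_le_first_difference fw (proj1 fz)) => e; rewrite eq_sym => /mf.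
by rewrite {1}/m (min_r (ltW zwf)) minC.
Qed.

(** One operation serves twice: [nudge z z w] is the midpoint of z and w, and
with psi the limit of z it transplants half of the move from psi to w to the
nearby flow z. *)
Definition nudge z psi w : flow P := fun e => z e + 2^-1 * (w e - psi e).

Lemma sum_nudge (Q : pred (edge (graph P))) z psi w :
  \sum_(e | Q e) nudge z psi w e =
  \sum_(e | Q e) z e + 2^-1 * (\sum_(e | Q e) w e - \sum_(e | Q e) psi e).
Proof. by rewrite big_split /= -mulr_sumr big_split /= sumrN. Qed.

Lemma totalE phi : total phi = \sum_e phi e.
Proof.
by rewrite (partition_big (fun e : edge (graph P) => (val e).1) predT).
Qed.

Definition midpoint_convex F : Prop :=
  forall z w, F z -> F w -> F (nudge z z w).

Lemma feasible_midpoint : midpoint_convex (@feasible R S D P).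
Proof.
move=> z w [z1 z2 z3] [w1 w2 w3]; split.
- move=> e; have [z0 zu] := z1 e; have [w0 wu] := w1 e; rewrite /nudge.
  split; first by lra.
  move: zu wu; case: (capacity P e) => [r||]; rewrite ?leey ?leeNy_eq//.
  by rewrite !lee_fin => *; lra.
- move=> i; have := z2 i; have := w2 i.
  by rewrite /transferS sum_nudge => *; lra.
- move=> i; have := z3 i; have := w3 i.
  by rewrite /transferD sum_nudge => *; lra.
Qed.

Lemma max_flows_midpoint : midpoint_convex (@max_flows R S D P).
Proof.
move=> z w [fz mz] [fw mw]; split; first exact: feasible_midpoint.
move=> psi fpsi; have := mz _ fpsi; have := mw _ fpsi.
by rewrite !totalE sum_nudge => *; lra.
Qed.

Lemma flow_le_supply z e : feasible z -> z e <= supply P (val e).1.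
Proof.
move=> [z1 z2 _]; apply: le_trans (z2 _); rewrite /transferS (bigD1 e)//=.
by rewrite lerDl sumr_ge0// => e' _; have [] := z1 e'.
Qed.

Lemma flow_le_demand z e : feasible z -> z e <= demand P (val e).2.
Proof.
move=> [z1 _ z3]; apply: le_trans (z3 _); rewrite /transferD (bigD1 e)//=.
by rewrite lerDl sumr_ge0// => e' _; have [] := z1 e'.
Qed.

Notation flows := {ptws edge (graph P) -> R}.

Lemma flow_continuous e : continuous (fun phi : flows => phi e).
Proof. exact: (@proj_continuous _ (fun=> R) e). Qed.

Lemma sum_flow_continuous (Q : pred (edge (graph P))) :
  continuous (fun phi : flows => \sum_(e | Q e) phi e).
Proof.
apply: continuous_big => [|e _]; first exact: add_continuous.
exact: flow_continuous.
Qed.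

Lemma closed_sublevel (g : flows -> R) c :
  continuous g -> closed [set phi | g phi <= c].
Proof.
move=> cg; apply: (@preimage_closed _ _ g [set x | x <= c]) => [x _|].
  exact: cg.
exact: closed_le.
Qed.

Lemma closed_superlevel (g : flows -> R) c :
  continuous g -> closed [set phi | c <= g phi].
Proof.
move=> cg; apply: (@preimage_closed _ _ g [set x | c <= x]) => [x _|].
  exact: cg.
exact: closed_ge.
Qed.

(** Each edge is bounded by the supply at its origin, even when its capacity is
infinite. *)
Lemma compact_feasible : compact (@feasible R S D P : set flows).
Proof.
pose B e := `[0, supply P (val e).1] `&` [set x : R | (x%:E <= capacity P e)%E].
pose box := [set phi : flows | forall e, B e (phi e)].
pose boundS := [set phi : flows | forall i, transferS phi i <= supply P i].
pose boundD := [set phi : flows | forall j, transferD phi j <= demand P j].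
have cbox : compact box.
  apply: (@tychonoff _ (fun=> R) B) => e; apply: compact_closedI.
    exact: segment_compact.
  rewrite -[X in closed X]setCK; apply: open_closedC.
  rewrite [X in open X](_ : _ = [set x : R | (capacity P e < x%:E)%E]).
    exact: open_ereal_gt.
  by apply/seteqP; split => x /=; rewrite ltNge => /negP.
rewrite [X in compact X](_ : _ = box `&` (boundS `&` boundD)).
  apply: compact_closedI => //; apply: closedI; apply: closed_forall => i;
  apply: closed_sublevel; exact: sum_flow_continuous.
apply/seteqP; split => phi /=.
  move=> fphi; have [p1 p2 p3] := fphi.
  split => // e; split; last by have [] := p1 e.
  by rewrite /= in_itv/= (flow_le_supply e fphi) andbT; have [] := p1 e.
move=> [bphi [p2 p3]]; split => // e; have [/=] := bphi e.
by rewrite in_itv/= => /andP[].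
Qed.

Lemma feasible0 : valid P -> @feasible R S D P (fun=> 0).
Proof.
move=> [s0 d0 c0]; split => // [i|j]; first by rewrite /transferS big1.
by rewrite /transferD big1.
Qed.

Lemma total_continuous : continuous (@total R S D P : flows -> R).
Proof.
rewrite (_ : @total R S D P = fun phi => \sum_e phi e).
  exact: sum_flow_continuous.
by apply/funext => phi; exact: totalE.
Qed.

Lemma max_flows_neq0 : valid P -> @max_flows R S D P !=set0.
Proof.
move=> vP; have f0 : @feasible R S D P !=set0.
  by exists (fun=> 0); exact: feasible0.
have [||z /set_mem fz mz] := @compact_EVT_max flows R (@total R S D P) _ f0.
- exact: compact_feasible.
- exact/continuous_subspaceT/total_continuous.
- by exists z; split => // psi fpsi; exact/mz/mem_set.
Qed.

Lemma compact_max_flows : compact (@max_flows R S D P : set flows).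
Proof.
have [->|/set0P[z [fz mz]]] := eqVneq (@max_flows R S D P : set flows) set0.
  exact: compact0.
rewrite [X in compact X](_ : _ =
  (@feasible R S D P) `&` [set phi : flows | total z <= total phi]).
  apply: compact_closedI; first exact: compact_feasible.
  exact/closed_superlevel/total_continuous.
apply/seteqP; split => phi /= [fphi mphi]; split => //.
  exact: mphi.
by move=> psi /mz /le_trans; apply.
Qed.

(** * The edge-fair algorithm *)

(** The minimum over A of a flow is continuous in the flow, so it has a maximum
on the compact set F. *)
Lemma optimal_value_attained A F : A != finset.set0 -> F !=set0 ->
  compact (F : set flows) ->
  (exists2 z, F z & forall e, e \in A -> optimal_value A F <= z e) /\
  (forall z l, F z -> (forall e, e \in A -> l <= z e) ->
     l <= optimal_value A F).
Proof.
move=> /set0Pn[e0 e0A] F0 cF.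
(* As e0 is in A, the initial value phi e0 does not change the minimum. *)
pose g (phi : flows) : R := \big[Num.min/phi e0]_(e in A) phi e.
have gP phi l : (l <= g phi) <-> (forall e, e \in A -> l <= phi e).
  split=> [lg e eA|lA]; first by apply: le_trans lg _; apply: bigmin_le_cond.
  by apply/bigmin_geP; split => //; exact: lA.
have cg : continuous g.
  rewrite /g; elim: (index_enum _) => [|e s IHs].
    rewrite [X in continuous X](_ : _ = fun phi : flows => phi e0).
      exact: flow_continuous.
    by apply/funext => phi; rewrite big_nil.
  pose h (phi : flows) : R := \big[Num.min/phi e0]_(e <- s | e \in A) phi e.
  rewrite [X in continuous X](_ : _ =
    if e \in A then (fun phi : flows => phi e) \min h else h).
    by case: ifP => // _; apply: min_fun_continuous IHs; exact: flow_continuous.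
  by apply/funext => phi; rewrite big_cons; case: ifP.
have [|z /set_mem Fz gz] := @compact_EVT_max flows R g F F0 cF.
  exact: continuous_subspaceT.
have ub w l : F w -> (forall e, e \in A -> l <= w e) -> l <= g z.
  by move=> Fw /gP /le_trans; apply; exact/gz/mem_set.
have optE : optimal_value A F = g z.
  apply/eqP; rewrite eq_le; apply/andP; split.
    apply: sup_le_ub => [|l [w Fw wA]]; last exact: ub wA.
    by exists (g z), z => //; exact/gP.
  apply: ub_le_sup; first by exists (g z) => l [w Fw wA]; exact: ub wA.
  by exists z => //; exact/gP.
rewrite optE; split; last exact: ub.
by exists z => //; exact/gP.
Qed.

(** The midpoint of two flows that are at least l exceeds l wherever one of them
does, so the edges can be treated one at a time. *)
Lemma common_excess l F (s : seq (edge (graph P))) :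
  midpoint_convex F -> F !=set0 -> (forall z e, F z -> e \in s -> l <= z e) ->
  (forall e, e \in s -> exists2 z, F z & l < z e) ->
  exists2 z, F z & forall e, e \in s -> l < z e.
Proof.
move=> mF [z0 Fz0]; elim: s => [|e s IHs] lF ex; first by exists z0.
have [||z Fz zs] := IHs.
- by move=> z e' Fz e's; apply: lF => //; rewrite inE e's orbT.
- by move=> e' e's; apply: ex; rewrite inE e's orbT.
have [w Fw we] := ex e (mem_head _ _).
exists (nudge z z w) => [|e' e's]; first exact: mF.
rewrite /nudge; have le := lF _ _ Fz e's; have le' := lF _ _ Fw e's.
by move: e's; rewrite inE => /orP[/eqP ee|/zs]; [subst e'|]; lra.
Qed.

(** The last clause is the heart of the matter: a maximum flow w that keeps to
the bounds min (z e, z f) of a remaining flow z has not been eliminated as long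
as f is active, and does not exceed z at f after f has been dropped.  When A is
empty, it says that the remaining flows are fair. *)
Definition state_invariant A F : Prop :=
  [/\ F !=set0, compact (F : set flows), midpoint_convex F,
      F `<=` @max_flows R S D P &
      forall z w f, F z -> max_flows w ->
        (forall e, Num.min (z e) (z f) <= w e) ->
        if f \in A then F w else w f <= z f].

Lemma edge_fair_step_invariant A F : A != finset.set0 -> state_invariant A F ->
  let st := edge_fair_step (A, F) in
  state_invariant st.1 st.2 /\ (#|st.1| < #|A|)%N.
Proof.
move=> A0 [F0 cF mF sF iF]; rewrite /edge_fair_step (negbTE A0).
set l := optimal_value A F.
set F' := [set phi | F phi /\ _]; set A' := [set e in A | _]%SET => /=.
have [[z0 Fz0 z0A] lmax] := optimal_value_attained A0 F0 cF.
have F'0 : F' !=set0 by exists z0.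
have mF' : midpoint_convex F'.
  move=> z w [Fz zA] [Fw wA]; split=> [|e eA]; first exact: mF.
  by rewrite /nudge; have := zA _ eA; have := wA _ eA; rewrite -/l => *; lra.
have sA' : A' \subset A by apply/fintype.subsetP => e; rewrite inE => /andP[].
split; last first.
  apply: proper_card; rewrite finset.properEneq sA' andbT; apply/eqP => eqA.
  have [||z [Fz _] zA] := @common_excess l F' (enum A) mF' F'0.
  - by move=> z e [_ zA]; rewrite mem_enum; exact: zA.
  - by move=> e; rewrite mem_enum -eqA inE => /andP[_ /asboolP].
  have [e0 e0A] := finset.set0Pn _ A0.
  have [e eA mine] := @arg_minP _ _ _ e0 (mem A) z e0A.
  (* If no edge were dropped, the minimum of z over A would exceed the optimal
     value. *)
  have := lmax z (z e) Fz mine; rewrite leNgt zA //.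
  by rewrite mem_enum.
split => //.
- rewrite [X in compact X](_ : _ = F `&`
    [set phi | forall e, [set phi : flows | e \in A -> l <= phi e] phi]).
    apply: compact_closedI => //; apply: closed_forall => e.
    have [eA|_] := boolP (e \in A).
      rewrite [X in closed X](_ : _ = [set phi : flows | l <= phi e]).
        exact/closed_superlevel/flow_continuous.
      by apply/seteqP; split => phi /=; [exact|].
    by rewrite [X in closed X](_ : _ = setT); [exact: closedT|exact/seteqP].
  by [].
- by move=> z [/sF].
- move=> z w f [Fz zA] mw dom; have [fA|fA] := boolP (f \in A); last first.
    have -> : f \in A' = false.
      by apply/negP => /(fintype.subsetP sA'); exact/negP.
    by have := iF _ _ _ Fz mw dom; rewrite (negbTE fA).
  (* For active e and f both z e and z f are at least l, hence so is w e. *)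
  have F'w : F' w.
    split; first by have := iF _ _ _ Fz mw dom; rewrite fA.
    by move=> e eA; apply: le_trans (dom e); rewrite le_min !zA.
  have [//|] := boolP (f \in A'); rewrite inE fA/= => /asboolPn nex.
  apply: le_trans (zA f fA); rewrite leNgt; apply/negP => lw.
  by apply: nex; exists w.
Qed.

Lemma edge_fair_state_invariant t : valid P ->
  state_invariant (edge_fair_state P t).1 (edge_fair_state P t).2 /\
  (#|(edge_fair_state P t).1| <= #|edge (graph P)| - t)%N.
Proof.
move=> vP; elim: t => [|t].
  split; last by rewrite /= cardsT subn0.
  split => //=; [exact: max_flows_neq0|exact: compact_max_flows|
    exact: max_flows_midpoint|by move=> z w f _; rewrite inE].
rewrite /edge_fair_state iterS -/(edge_fair_state P t).
case: (edge_fair_state P t) => A F [iAF cA].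
have [A0|/eqP A0] := pselect (A = finset.set0).
  have -> : edge_fair_step (A, F) = (A, F) by rewrite /edge_fair_step A0 eqxx.
  by split => //=; rewrite A0 cards0.
have [i c] := edge_fair_step_invariant A0 iAF; split => //.
by rewrite subnS -ltnS (leq_trans c)// (leq_trans cA)// leqSpred.
Qed.

Lemma edge_fair_output_fair phi : valid P -> edge_fair_output phi -> fair phi.
Proof.
move=> vP [t [A0 Fphi]].
have [[_ _ _ sF iF] _] := edge_fair_state_invariant t vP.
have Fp : (edge_fair_state P t).2 phi by rewrite Fphi.
split=> [|w f mw dom]; first exact: sF.
by have := iF _ _ _ Fp mw dom; rewrite A0 inE.
Qed.

Lemma edge_fair_output_exists :
  valid P -> exists phi : flow P, edge_fair_output phi.
Proof.
move=> vP; pose t := #|edge (graph P)|.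
have [[[z Fz] _ _ sF iF]] := edge_fair_state_invariant t vP.
rewrite subnn leqn0 cards_eq0 => /eqP A0.
have fF w : (edge_fair_state P t).2 w -> fair w.
  move=> Fw; split=> [|w' f mw' dom]; first exact: sF.
  by have := iF _ _ _ Fw mw' dom; rewrite A0 inE.
exists z, t; split => //; apply/seteqP; split => [w /fF fw|w ->//].
exact: fair_unique fw (fF _ Fz).
Qed.

Lemma edge_fair_outputP : valid P -> edge_fair_output (@edge_fair R S D P).
Proof. by move=> vP; apply: xgetPex; exact: edge_fair_output_exists. Qed.

Lemma edge_fairP : valid P -> fair (@edge_fair R S D P).
Proof. by move=> vP; exact: edge_fair_output_fair (edge_fair_outputP vP). Qed.

Lemma fair_edge_fair z : valid P -> fair z -> @edge_fair R S D P = z.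
Proof. by move=> /edge_fairP fz; exact: fair_unique. Qed.

End FairFlows.

(** * Symmetry *)

Section Symmetry.
Variables (R : realType) (S D : finType).
Implicit Types (pi : {perm S}) (sigma : {perm D}) (P : problem R S D).

Lemma permuted_sym pi sigma P P' :
  permuted pi sigma P P' -> permuted pi^-1 sigma^-1 P' P.
Proof.
move=> [Hg Hs Hd Hc]; split => [i j|i|j|e e' ee'].
- by rewrite -Hg !permKV.
- by rewrite -Hs permKV.
- by rewrite -Hd permKV.
- by rewrite (Hc e' e)// ee' /= !permKV -surjective_pairing.
Qed.

Lemma permute_edge_subproof pi sigma P P' (H : permuted pi sigma P P')
  (e : edge (graph P)) : (pi (val e).1, sigma (val e).2) \in graph P'.
Proof. by have [-> _ _ _] := H; rewrite -surjective_pairing; exact: valP. Qed.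

Definition permute_edge pi sigma P P' (H : permuted pi sigma P P')
    (e : edge (graph P)) : edge (graph P') :=
  exist _ (pi (val e).1, sigma (val e).2) (permute_edge_subproof H e).

Definition pull_flow pi sigma P P' (H : permuted pi sigma P P')
  (z : flow P') : flow P := z \o permute_edge H.

Section Pull.
Variables (pi : {perm S}) (sigma : {perm D}) (P P' : problem R S D).
Hypothesis H : permuted pi sigma P P'.
Let H' := permuted_sym H.

Lemma permute_edgeK : cancel (permute_edge H) (permute_edge H').
Proof. by move=> e; apply: val_inj; rewrite /= !permK -surjective_pairing. Qed.

Lemma permute_edgeVK : cancel (permute_edge H') (permute_edge H).
Proof. by move=> e; apply: val_inj; rewrite /= !permKV -surjective_pairing. Qed.

Lemma permute_edge_bij : bijective (permute_edge H).
Proof. exact: Bijective permute_edgeK permute_edgeVK. Qed.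

Lemma pull_transferS z i : transferS (pull_flow H z) i = transferS z (pi i).
Proof.
rewrite /transferS (reindex (permute_edge H)) /=; last first.
  exact/onW_bij/permute_edge_bij.
by apply: eq_bigl => e; rewrite /= (inj_eq perm_inj).
Qed.

Lemma pull_transferD z j : transferD (pull_flow H z) j = transferD z (sigma j).
Proof.
rewrite /transferD (reindex (permute_edge H)) /=; last first.
  exact/onW_bij/permute_edge_bij.
by apply: eq_bigl => e; rewrite /= (inj_eq perm_inj).
Qed.

Lemma pull_total z : total (pull_flow H z) = total z.
Proof.
rewrite /total [RHS](reindex_inj (@perm_inj _ pi)) /=.
by apply: eq_bigr => i _; exact: pull_transferS.
Qed.

Lemma pull_feasible z : feasible z -> feasible (pull_flow H z).
Proof.
move=> [z1 z2 z3]; have [_ Hs Hd Hc] := H; split=> [e|i|j].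
- by rewrite -(Hc e (permute_edge H e) erefl); exact: z1.
- by rewrite pull_transferS -Hs.
- by rewrite pull_transferD -Hd.
Qed.

Lemma permuted_valid : valid P -> valid P'.
Proof.
move=> [s0 d0 c0]; have [_ Hs Hd Hc] := H'; split=> [i|j|e].
- by rewrite -Hs.
- by rewrite -Hd.
- by rewrite -(Hc e (permute_edge H' e) erefl).
Qed.

End Pull.

(** A competitor on P is compared with z after being pulled back along the inverse
permutations. *)
Lemma pull_max_flows pi sigma P P' (H : permuted pi sigma P P') z :
  max_flows z -> max_flows (pull_flow H z).
Proof.
move=> [fz mz]; split=> [|psi fpsi]; first exact: pull_feasible.
rewrite pull_total -(pull_total (permuted_sym H)).
exact/mz/pull_feasible.
Qed.

Lemma pull_fair pi sigma P P' (H : permuted pi sigma P P') z :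
  fair z -> fair (pull_flow H z).
Proof.
move=> [mz fz]; split=> [|w f mw dom]; first exact: pull_max_flows.
have := fz _ (permute_edge H f) (pull_max_flows (permuted_sym H) mw).
rewrite /pull_flow /= permute_edgeK; apply => e.
have := dom (permute_edge (permuted_sym H) e).
by rewrite /pull_flow /= permute_edgeVK.
Qed.

End Symmetry.

Lemma edge_fair_symmetric (R : realType) : symmetric_rule (@edge_fair_rule R).
Proof.
move=> S D pi sigma P P' vP H e e' ee'.
have -> : e' = permute_edge H e by exact: val_inj.
pose z' := @edge_fair R S D P'.
rewrite /edge_fair_rule (@fair_edge_fair _ _ _ P (pull_flow H z'))//.
by apply/pull_fair/edge_fairP/(permuted_valid H).
Qed.

(** * Consistency *)

Section Reduction.
Variables (R : realType) (S D : finType) (P : problem R S D).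
Variables (z : flow P) (e0 : edge (graph P)).
Local Notation P' := (reduced z e0).
Local Notation edge' := (edge (graph P :\ val e0)).

Definition restrict_flow (w : flow P) : flow P' :=
  fun e => w (remaining_edge e).

Definition extend_flow (w : flow P') : flow P := fun e =>
  if insub (val e) : option edge' is Some e'
  then w e' else z e0.

Lemma extend_flow_remaining w (e : edge') :
  extend_flow w (remaining_edge e) = w e.
Proof. by rewrite /extend_flow /= valK. Qed.

Lemma extend_flow_removed w : extend_flow w e0 = z e0.
Proof. by rewrite /extend_flow insubF // in_setD1 eqxx. Qed.

Lemma edge_removed_or_remaining e :
  e = e0 \/ exists e' : edge', e = remaining_edge e'.
Proof.
have [->|ne] := eqVneq e e0; [by left|right].
have He : val e \in (graph P :\ val e0)%SET.
  by rewrite in_setD1 (inj_eq val_inj) ne; exact: valP.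
by exists (exist _ (val e) He); apply: val_inj.
Qed.

Lemma sum_edges (Q : pred (S * D)) (F : edge (graph P) -> R) :
  \sum_(e : edge (graph P) | Q (val e)) F e =
  (if Q (val e0) then F e0 else 0) +
  \sum_(e : edge' | Q (val e)) F (remaining_edge e).
Proof.
have rem : \sum_(e : edge (graph P) | Q (val e) && (e != e0)) F e =
    \sum_(e : edge' | Q (val e)) F (remaining_edge e).
  pose h (e : edge (graph P)) := insub (val e) : option edge'.
  rewrite (reindex_omap (@remaining_edge _ _ _ (val e0)) h);
    last move=> e /andP[_ ee0].
    apply: eq_bigl => e; rewrite /h /= valK eqxx andbT.
    suff -> : remaining_edge e != e0 by rewrite andbT.
    rewrite -(inj_eq val_inj) /=.
    by have := valP e; rewrite in_setD1 => /andP[].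
  have [|[e' ->]] := edge_removed_or_remaining e; first by move/eqP: ee0.
  by rewrite /h /= valK.
case: ifPn => Q0; first by rewrite (bigD1 e0)//= rem.
rewrite add0r -rem; apply: eq_bigl => e.
by case: eqP => [->|_]; rewrite ?andbT// (negbTE Q0).
Qed.

Lemma extend_transferS w i :
  transferS (extend_flow w) i =
  (if (val e0).1 == i then z e0 else 0) + transferS w i.
Proof.
rewrite /transferS (sum_edges (fun x => x.1 == i)) extend_flow_removed.
by congr (_ + _); apply: eq_bigr => e _; exact: extend_flow_remaining.
Qed.

Lemma extend_transferD w j :
  transferD (extend_flow w) j =
  (if (val e0).2 == j then z e0 else 0) + transferD w j.
Proof.
rewrite /transferD (sum_edges (fun x => x.2 == j)) extend_flow_removed.
by congr (_ + _); apply: eq_bigr => e _; exact: extend_flow_remaining.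
Qed.

Lemma extend_total w : total (extend_flow w) = z e0 + total w.
Proof.
rewrite !totalE (sum_edges predT) extend_flow_removed.
by congr (_ + _); apply: eq_bigr => e _; exact: extend_flow_remaining.
Qed.

Hypothesis fz : feasible z.

(** The reduced bounds at the endpoints of e0 are the original ones minus z e0,
the amount that the extension puts back. *)
Lemma extend_feasible w : feasible (extend_flow w) <-> feasible w.
Proof.
have le_supply i : transferS (extend_flow w) i <= supply P i <->
    transferS w i <= supply P' i.
  rewrite extend_transferS /= eq_sym.
  by case: eqP => [->|_]; rewrite ?add0r// lerBrDl.
have le_demand j : transferD (extend_flow w) j <= demand P j <->
    transferD w j <= demand P' j.
  rewrite extend_transferD /= eq_sym.
  by case: eqP => [->|_]; rewrite ?add0r// lerBrDl.
split=> [] [w1 w2 w3]; split=> [e|i|j]; [|exact/le_supply|exact/le_demand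
  | |exact/le_supply|exact/le_demand].
  by rewrite -(extend_flow_remaining w e); exact: w1.
have [->|[e' ->]] := edge_removed_or_remaining e.
  by rewrite extend_flow_removed; have [] := fz.
by rewrite extend_flow_remaining; exact: w1.
Qed.

Lemma restrict_flowK : extend_flow (restrict_flow z) = z.
Proof.
apply/funext => e; have [->|[e' ->]] := edge_removed_or_remaining e.
  exact: extend_flow_removed.
by rewrite extend_flow_remaining.
Qed.

Lemma restrict_total : total z = z e0 + total (restrict_flow z).
Proof. by rewrite -extend_total restrict_flowK. Qed.

Lemma restrict_feasible : feasible (restrict_flow z).
Proof. by apply/extend_feasible; rewrite restrict_flowK. Qed.

Lemma extend_max_flows w :
  max_flows z -> max_flows w -> max_flows (extend_flow w).
Proof.
move=> [_ mz] [fw mw]; split; first exact/extend_feasible.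
move=> psi /mz /le_trans.
apply; rewrite extend_total restrict_total lerD2l.
exact/mw/restrict_feasible.
Qed.

Lemma restrict_max_flows : max_flows z -> max_flows (restrict_flow z).
Proof.
move=> [_ mz]; split; first exact: restrict_feasible.
move=> psi /extend_feasible/mz.
by rewrite extend_total restrict_total lerD2l.
Qed.

(** On e0 an extended flow equals z, so it respects the bound min (z e0, z f) for
free. *)
Lemma restrict_fair : fair z -> fair (restrict_flow z).
Proof.
move=> [mz fair_z]; split=> [|w f mw dom]; first exact: restrict_max_flows.
rewrite -(extend_flow_remaining w); apply: fair_z => [|e].
  exact: extend_max_flows.
have [->|[e' ->]] := edge_removed_or_remaining e.
  by rewrite extend_flow_removed ge_min lexx.
by rewrite extend_flow_remaining; exact: dom.
Qed.

Lemma reduced_valid : valid P -> valid P'.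
Proof.
move=> [s0 d0 c0]; split=> [i|j|e] /=; last exact: c0.
  by case: eqP => // ->; rewrite subr_ge0; exact: flow_le_supply.
by case: eqP => // ->; rewrite subr_ge0; exact: flow_le_demand.
Qed.

End Reduction.

Lemma edge_fair_consistent (R : realType) : edge_consistent (@edge_fair_rule R).
Proof.
move=> S D P e0 vP e; rewrite /edge_fair_rule.
set z := @edge_fair R S D P.
have fz : fair z by exact: edge_fairP.
have feas : feasible z by case: fz => -[].
pose w := @restrict_flow R S D P z e0 z.
rewrite (@fair_edge_fair _ _ _ (reduced z e0) w)//.
  exact: reduced_valid.
exact: restrict_fair.
Qed.

(** * Continuity *)

(** Here z t is a flow of the problem q t, and psi is its limit along G, in the
problem p that is the limit of q t. *)
Section FairLimit.
Variables (R : realType) (S D : finType) (E : {set S * D}).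
Variables (T : topologicalType) (G : set_system T).
Context {PG : ProperFilter G}.
Variables (q : T -> data R E) (p : data R E).
Variables (z : T -> edge E -> R) (psi : edge E -> R).
Local Notation P := (problem_of p).
Local Notation P_ t := (problem_of (q t)).

Hypothesis supply_cvg : forall i, supply (P_ t) i @[t --> G] --> supply P i.
Hypothesis demand_cvg : forall j, demand (P_ t) j @[t --> G] --> demand P j.
Hypothesis capacity_cvg : forall e : edge E,
  @capacity _ _ _ (P_ t) e @[t --> G] --> @capacity _ _ _ P e.
Hypothesis flow_cvg : forall e : edge E, z t e @[t --> G] --> psi e.

Lemma sum_flow_cvg (Q : pred (edge E)) :
  \sum_(e | Q e) z t e @[t --> G] --> \sum_(e | Q e) psi e.
Proof.
apply: cvg_big => [|e _]; first exact: add_continuous.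
exact: flow_cvg.
Qed.

Lemma feasible_limit :
  (\forall t \near G, @feasible R S D (P_ t) (z t)) ->
  @feasible R S D P psi.
Proof.
move=> fz; split=> [e|i|j]; first split.
- apply: (@ler_cvg_to _ G _ R (fun=> 0) _ 0 _ (cvg_cst _) (@flow_cvg e)).
  by apply: filterS fz => t [zt _ _]; have [] := zt e.
- apply: (@lee_cvg_to _ G _ R (fun t => (z t e)%:E) _ _ _ _ (@capacity_cvg e)).
    by apply: cvg_EFin; [exact: nearW|exact: flow_cvg].
  by apply: filterS fz => t [zt _ _]; have [] := zt e.
- apply: (@ler_cvg_to _ G _ R (fun t => @transferS _ _ _ (P_ t) (z t) i)
    _ _ _ _ (@supply_cvg i)); first exact: sum_flow_cvg.
  by apply: filterS fz => t [_ zt _]; exact: zt.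
- apply: (@ler_cvg_to _ G _ R (fun t => @transferD _ _ _ (P_ t) (z t) j)
    _ _ _ _ (@demand_cvg j)); first exact: sum_flow_cvg.
  by apply: filterS fz => t [_ _ zt]; exact: zt.
Qed.

Definition nudged (w : edge E -> R) t : edge E -> R :=
  @nudge R S D P (z t) psi w.

Lemma sum_nudged_near (Q : pred (edge E)) (w : edge E -> R) (r : T -> R) c :
  r @ G --> c -> (\forall t \near G, \sum_(e | Q e) z t e <= r t) ->
  \sum_(e | Q e) w e <= c ->
  \forall t \near G, \sum_(e | Q e) nudged w t e <= r t.
Proof.
move=> rc zr wc.
apply: filterS (real_slack_near (@sum_flow_cvg Q) rc zr wc) => t.
by rewrite [X in _ -> X <= _](@sum_nudge R S D P Q (z t) psi w).
Qed.

Lemma nudged_feasible (w : edge E -> R) :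
  (\forall t \near G, @feasible R S D (P_ t) (z t)) -> @feasible R S D P w ->
  \forall t \near G, @feasible R S D (P_ t) (nudged w t).
Proof.
move=> fz [w1 w2 w3].
have ge0 : \forall t \near G, forall e, 0 <= nudged w t e.
  apply: filter_forall => e; have [w0 _] := w1 e.
  have z0 : \forall t \near G, - z t e <= 0.
    by apply: filterS fz => t [zt _ _]; rewrite oppr_le0; have [] := zt e.
  have w0' : - w e <= 0 by rewrite oppr_le0.
  have zcvg : - z t e @[t --> G] --> - psi e by apply: cvgN; exact: flow_cvg.
  apply: filterS (real_slack_near zcvg (cvg_cst _) z0 w0') => t.
  by rewrite /nudged /nudge; lra.
have capE : \forall t \near G, forall e,
    ((nudged w t e)%:E <= @capacity _ _ _ (P_ t) e)%E.
  apply: filter_forall => e; have [_ wc] := w1 e.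
  apply: slack_near wc; [exact: flow_cvg|exact: capacity_cvg|].
  by apply: filterS fz => t [zt _ _]; have [] := zt e.
have capS : \forall t \near G, forall i,
    @transferS _ _ _ (P_ t) (nudged w t) i <= supply (P_ t) i.
  apply: filter_forall => i; apply: sum_nudged_near (w2 i) => //.
  by apply: filterS fz => t [_ zt _]; exact: zt.
have capD : \forall t \near G, forall j,
    @transferD _ _ _ (P_ t) (nudged w t) j <= demand (P_ t) j.
  apply: filter_forall => j; apply: sum_nudged_near (w3 j) => //.
  by apply: filterS fz => t [_ _ zt]; exact: zt.
apply: filterS (filterI (filterI ge0 capE) (filterI capS capD)).
by move=> t [[h1 h2] [h3 h4]]; split.
Qed.

Let total_sum t (y : edge E -> R) : @total R S D (P_ t) y = \sum_e y e.
Proof. exact: (@totalE R S D (P_ t)). Qed.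

Let total_sum0 (y : edge E -> R) : @total R S D P y = \sum_e y e.
Proof. exact: (@totalE R S D P). Qed.

Lemma total_nudged (w : edge E -> R) t : @total R S D (P_ t) (nudged w t) =
  @total R S D (P_ t) (z t) + 2^-1 * (@total R S D P w - @total R S D P psi).
Proof.
rewrite !total_sum !total_sum0.
exact: (@sum_nudge R S D P predT (z t) psi w).
Qed.

(** If a feasible w had a larger total than psi, moving z t by half of w - psi
would increase its total as well. *)
Lemma max_flows_limit :
  (\forall t \near G, @max_flows R S D (P_ t) (z t)) -> @max_flows R S D P psi.
Proof.
move=> mz.
have fz : \forall t \near G, @feasible R S D (P_ t) (z t).
  by apply: filterS mz => t [].
split=> [|w fw]; first exact: feasible_limit.
have [t [[_ mzt] /mzt]] := filter_ex (filterI mz (nudged_feasible fz fw)).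
by rewrite total_nudged; lra.
Qed.

Lemma nudged_max_flows (w : edge E -> R) :
  (\forall t \near G, @max_flows R S D (P_ t) (z t)) -> @max_flows R S D P w ->
  \forall t \near G, @max_flows R S D (P_ t) (nudged w t).
Proof.
move=> mz [fw mw]; have [fpsi mpsi] := max_flows_limit mz.
have fz : \forall t \near G, @feasible R S D (P_ t) (z t).
  by apply: filterS mz => t [].
apply: filterS2 mz (nudged_feasible fz fw) => t [_ mzt] fs; split=> // phi /mzt.
by rewrite total_nudged; have := mpsi _ fw; have := mw _ fpsi; lra.
Qed.

(** If w contradicts the fairness of psi at f, then [nudged w t] contradicts that
of z t.  Only edges e with w e < psi e go down; for them psi f <= w e, so the
limit (psi e + w e) / 2 of the nudged flow exceeds the limit psi f of z t f. *)
Lemma fair_limit :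
  (\forall t \near G, @fair R S D (P_ t) (z t)) -> @fair R S D P psi.
Proof.
move=> fz.
have mz : \forall t \near G, @max_flows R S D (P_ t) (z t).
  by apply: filterS fz => t [].
split=> [|w f mw dom]; first exact: max_flows_limit.
rewrite leNgt; apply/negP => lt_f.
have domt : \forall t \near G, forall e,
    Num.min (z t e) (z t f) <= nudged w t e.
  apply: filter_forall => e; have [le_e|lt_e] := leP (psi e) (w e).
    by apply: nearW => t; rewrite ge_min /nudged /nudge; apply/orP; left; lra.
  have {}dom : psi f <= w e.
    by have := dom e; rewrite ge_min leNgt lt_e.
  near=> t; rewrite ge_min; apply/orP; right; apply: ltW.
  near: t; apply: (lt_cvg_near (@flow_cvg f)).
    by apply: cvgD; [exact: flow_cvg|exact: cvg_cst].
  by lra.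
have [t [[[_ fzt] mst] domt']] :=
  filter_ex (filterI (filterI fz (nudged_max_flows mz mw)) domt).
have := fzt _ f mst domt'; rewrite /nudged /nudge; lra.
Unshelve. all: by end_near. Qed.

End FairLimit.

Lemma edge_fair_continuous (R : realType) :
  continuous_rule (@edge_fair_rule R).
Proof.
move=> S D E; apply/subspace_continuousP => p vp.
set V := [set p : data R E | valid (problem_of p)].
pose f (q : data R E) : edge E -> R := @edge_fair R S D (problem_of q).
apply: (@cvg_of_ultra _ {ptws edge E -> R} _ f) => G UG VG.
have Gp : G --> p.
  by move=> A Ap; apply: VG; apply: filterS Ap => ? ?.
have GV : G V by apply: VG; exact: withinT.
have Gp1 : q.1 @[q --> G] --> p.1 by apply: cvg_trans (cvg_app _ Gp) cvg_fst.
have scvg i : supply (problem_of q) i @[q --> G] --> supply (problem_of p) i.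
  have Gp11 : q.1.1 @[q --> G] --> p.1.1.
    apply: (@cvg_comp _ _ _ (fun q : data R E => q.1) fst _ _ _ Gp1).
    exact: cvg_fst.
  exact: (@cvg_comp _ _ _ (fun q : data R E => q.1.1) (@proj _ (fun=> R) i)
    _ _ _ Gp11 (@proj_continuous _ (fun=> R) i _)).
have dcvg i : demand (problem_of q) i @[q --> G] --> demand (problem_of p) i.
  have Gp12 : q.1.2 @[q --> G] --> p.1.2.
    apply: (@cvg_comp _ _ _ (fun q : data R E => q.1) snd _ _ _ Gp1).
    exact: cvg_snd.
  exact: (@cvg_comp _ _ _ (fun q : data R E => q.1.2) (@proj _ (fun=> R) i)
    _ _ _ Gp12 (@proj_continuous _ (fun=> R) i _)).
have ucvg (e : edge E) : @capacity _ _ _ (problem_of q) e @[q --> G] -->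
    @capacity _ _ _ (problem_of p) e.
  have Gp2 : q.2 @[q --> G] --> p.2 by apply: cvg_trans (cvg_app _ Gp) cvg_snd.
  exact: (@cvg_comp _ _ _ (fun q : data R E => q.2) (@proj _ (fun=> \bar R) e)
    _ _ _ Gp2 (@proj_continuous _ (fun=> \bar R) e _)).
have fairG : \forall q \near G, @fair R S D (problem_of q) (f q).
  by apply: filterS GV => q; exact: edge_fairP.
have fcvg e : exists l : R, f q e @[q --> G] --> l.
  apply: (@ultra_bounded_cvg _ _ _ _ 0 (supply (problem_of p) (val e).1 + 1)).
  have sG : \forall q \near G,
      supply (problem_of q) (val e).1 < supply (problem_of p) (val e).1 + 1.
    by apply: (cvgr_lt _ (scvg _)); rewrite ltrDl.
  apply: filterS2 fairG sG => q [[feas _] _] sq.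
  have [f0 _ _] := feas; have [-> _] := f0 e.
  have := @flow_le_supply R S D (problem_of q) _ e feas.
  by move=> /le_trans -> //; exact: ltW.
have [psi psiP] := choice fcvg.
have fp : f p = psi.
  apply: (@fair_edge_fair R S D (problem_of p) psi vp).
  exact: (fair_limit scvg dcvg ucvg psiP).
apply: (@cvg_ptws _ R (f @ G) (f p)) => e; rewrite fp; exact: psiP.
Qed.

Theorem theorem1 (R : realType) :
  [/\ selected_by_edge_fair_algorithm (@edge_fair_rule R),
      symmetric_rule (@edge_fair_rule R),
      continuous_rule (@edge_fair_rule R)
    & edge_consistent (@edge_fair_rule R)].
Proof.
split; [|exact: edge_fair_symmetric|exact: edge_fair_continuous
  |exact: edge_fair_consistent].
by move=> S D P vP; split; [case: (edge_fairP vP)|exact: edge_fair_outputP].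
Qed.
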